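(* Consider the group $G=Q_{4p}$, where $p$ is a prime. (a) If $p=2$ then $M_1(\mathcal{B}(G))=1082$ and $M_2(\mathcal{B}(G))=1018$. (b) If $p \geq 3$ then $M_1(\mathcal{B}(G))=154p^4-288p^3+140p^2+144p+20$ and $M_2(\mathcal{B}(G))=154p^4-288p^3+124p^2+144p+20$. Further, (in both cases) $\frac{M_{2}(\mathcal{B}(G))}{|e(\mathcal{B}(G))|} \geq \frac{M_{1}(\mathcal{B}(G))}{|V(\mathcal{B}(G))|}$.
   Context: $Q_{4n}=\langle a,b : a^{2n}=1,\ b^2=a^n,\ bab^{-1}=a^{-1}\rangle$ is the dicyclic group of order $4n$. For a finite group $G$, $L(G)$ denotes the set of all subgroups of $G$. The subgroup generating bipartite graph $\mathcal{B}(G)$ is the simple undirected bipartite graph whose vertex set is the disjoint union $(G\times G)\sqcup L(G)$, where $(x,y)\in G\times G$ and $H\in L(G)$ are adjacent if and only if $H=\langle x,y\rangle$ (the subgroup generated by $x$ and $y$); there are no other edges. For a finite simple graph $\mathcal{G}$ with vertex set $V(\mathcal{G})$ and edge set $e(\mathcal{G})$, the first and second Zagreb indices are $M_1(\mathcal{G})=\sum_{v\in V(\mathcal{G})}\deg(v)^2$ and $M_2(\mathcal{G})=\sum_{uv\in e(\mathcal{G})}\deg(u)\deg(v)$. *)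

(* Defs.v *)
From HB Require Import structures.
From mathcomp Require Import all_boot all_order all_algebra all_fingroup.
Set Implicit Arguments.
Unset Strict Implicit.
Unset Printing Implicit Defensive.

Record sgraph := SGraph {
  vertex : finType;
  adj : rel vertex;
  adj_sym : symmetric adj;
  adj_irrefl : irreflexive adj }.

Section Zagreb.
Variable Gr : sgraph.
Implicit Types u v : vertex Gr.

Definition deg v : nat := #|[set u | adj v u]|.

Definition edges : {set {set vertex Gr}} :=
  [set f | [exists u, exists v, adj u v && (f == [set u; v])]].

Definition zagreb1 : nat := \sum_(v : vertex Gr) deg v ^ 2.

(* An edge f is a two-element set [set u; v], so the inner product is         *)
(* deg u * deg v.                                                             *)
Definition zagreb2 : nat := \sum_(f in edges) \prod_(v in f) deg v.

End Zagreb.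

Section SubgroupGeneratingBipartiteGraph.
Variable gT : finGroupType.

(* A finite group is a finGroupType here, so its subgroups are all the        *)
(* elements of {group gT}.                                                    *)
Definition sgb_vertex : finType := (gT * gT + {group gT})%type.

Definition sgb_adj : rel sgb_vertex := fun u v =>
  match u, v with
  | inl (x, y), inr H => (H : {set gT}) == <<[set x; y]>>%g
  | inr H, inl (x, y) => (H : {set gT}) == <<[set x; y]>>%g
  | _, _ => false
  end.

Lemma sgb_adj_sym : symmetric sgb_adj.
Proof. by move=> [[x y]|H] [[z t]|K]. Qed.

Lemma sgb_adj_irrefl : irreflexive sgb_adj.
Proof. by move=> [[x y]|H]. Qed.

Definition sgb_graph : sgraph := SGraph sgb_adj_sym sgb_adj_irrefl.

End SubgroupGeneratingBipartiteGraph.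

(* The library's 'Q_m is only meaningful for m a power of 2, so the dicyclic  *)
(* group of order 4n is given by its presentation.                            *)
Definition dicyclic (n : nat) (gT : finGroupType) : Prop :=
  ([set: gT] \isog Grp (a : b : a ^+ (2 * n), b ^+ 2 = a ^+ n,
                                b * a * b^-1 = a^-1))%g.

(* Main.v *)
Require Import Defs.
From HB Require Import structures.
From mathcomp Require Import all_boot all_order all_algebra all_fingroup.
From mathcomp Require Import cyclic zify ring.
Import Order.TTheory GRing.Theory Num.Theory.

(** Write N(H) for the number of pairs generating the subgroup H.  In the
    subgroup generating bipartite graph of G every pair has degree 1 and H has
    degree N(H); each pair lies on exactly one edge.  Hence M2 is the sum S of
    the squares N(H)^2, M1 = |G|^2 + S, there are |G|^2 edges and
    |G|^2 + |L(G)| vertices.  Since the N(H) add up to |G|^2, the comparison of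
    M2 / |e| with M1 / |V| is, for every finite group, the Cauchy-Schwarz
    inequality (sum of the N(H))^2 <= |L(G)| * S ([zagreb_mean_leq]).

    To compute S for the dicyclic group of order 4p, let A be the cyclic
    subgroup generated by a, which has order 2p and index 2.  Every element
    outside A squares to the central involution a^p, so a subgroup H not
    contained in A meets A in a subgroup of index 2 in H and of even order
    dividing 2p: as p is prime, H has order 4 or is the whole group
    ([subgroup_out]).  The 2p elements outside A have order 4 and come in
    pairs generating the same subgroup, so p of these subgroups have order 4
    ([card_order4_out]).

    The values N(H) follow from the single identity that N(K), summed over the
    subgroups K of H, gives |H|^2 ([sum_gen_pairs]).  In a cyclic group,
    subgroups correspond to divisors of the order, and the identity determines
    N recursively: 1, 3, p^2 - 1, 3(p^2 - 1) on the subgroups of A of order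
    1, 2, p, 2p for p odd, and 12 in cyclic order 4; for G itself it leaves
    16p^2 - 4p^2 - 12p ([gen_pairs_setT]).

    That a group presented as dicyclic really has order 4p, rather than a
    smaller one, is shown by its right regular representation on 4p points
    ([dicyclic_model]). *)

Set Implicit Arguments.
Unset Strict Implicit.

(** * Zagreb indices in terms of generating pairs *)

Definition pair_group (gT : finGroupType) (u : gT * gT) : {group gT} :=
  <<[set u.1; u.2]>>%G.

Definition gen_pairs (gT : finGroupType) (H : {group gT}) : nat :=
  #|[set u : gT * gT | pair_group u == H]|.

Lemma pair_group_sub (gT : finGroupType) (K : {group gT}) (u : gT * gT) :
  (pair_group u \subset K) = (u \in setX K K).
Proof. by case: u => x y; rewrite gen_subG subUset !sub1set inE. Qed.

Section ZagrebOfSgb.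
Variable gT : finGroupType.
Notation B := (sgb_graph gT).

Lemma sgb_adj_pair (u : gT * gT) (v : vertex B) :
  adj (inl u : vertex B) v = (v == inr (pair_group u)).
Proof. by case: u v => x y [[z t]|H]. Qed.

Lemma deg_pair (u : gT * gT) : deg (inl u : vertex B) = 1%N.
Proof.
rewrite /deg (_ : [set v | _] = [set inr (pair_group u)]) ?cards1 //.
by apply/setP=> v; rewrite !inE sgb_adj_pair.
Qed.

Lemma deg_subgroup (H : {group gT}) : deg (inr H : vertex B) = gen_pairs H.
Proof.
rewrite /gen_pairs -(card_imset _ (@inl_inj _ {group gT})).
congr #|pred_of_set _|; apply/setP=> v; rewrite inE adj_sym.
apply/idP/imsetP => [|[u + ->]].
  case: v => [u|K] //; rewrite sgb_adj_pair => /eqP[->].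
  by exists u; rewrite ?inE.
by rewrite inE sgb_adj_pair => /eqP->.
Qed.

Lemma sum_gen_pairs_on (P : pred {group gT}) :
  \sum_(H : {group gT} | P H) gen_pairs H = #|[set u | P (pair_group u)]|.
Proof.
rewrite -sum1_card.
rewrite (partition_big (@pair_group gT) P) => [|u]; last by rewrite inE.
apply: eq_bigr => H PH; rewrite /gen_pairs -sum1_card; apply: eq_bigl => u.
by rewrite !inE; case: eqP => [->|]; rewrite ?PH ?andbF.
Qed.

(** A pair generates a subgroup of K exactly when both entries lie in K, so
    sorting the pairs of K by what they generate counts all of them. *)
Lemma sum_gen_pairs (K : {group gT}) :
  \sum_(H : {group gT} | H \subset K) gen_pairs H = (#|K| ^ 2)%N.
Proof.
rewrite sum_gen_pairs_on -mulnn -cardsX.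
by apply: eq_card => u; rewrite inE pair_group_sub.
Qed.

Lemma sum_gen_pairs_all :
  \sum_(H : {group gT}) gen_pairs H = (#|gT| ^ 2)%N.
Proof.
rewrite -cardsT -(sum_gen_pairs [set: gT]%G).
by apply: eq_bigl => H; rewrite subsetT.
Qed.

Lemma zagreb1_sgb :
  zagreb1 B = (#|gT| ^ 2 + \sum_(H : {group gT}) gen_pairs H ^ 2)%N.
Proof.
rewrite /zagreb1 big_sumType /=; congr (_ + _)%N; last first.
  by apply: eq_bigr => H _; rewrite deg_subgroup.
rewrite (eq_bigr (fun=> 1%N)) => [|u _]; last by rewrite deg_pair.
by rewrite sum1_card card_prod mulnn.
Qed.

Definition pair_edge (u : gT * gT) : {set vertex B} :=
  [set inl u; inr (pair_group u)].

Lemma pair_edge_inj : injective pair_edge.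
Proof.
move=> u v euv; have: (inl u : vertex B) \in pair_edge v.
  by rewrite -euv !inE eqxx.
by rewrite !inE orbF => /eqP[].
Qed.

Lemma edges_sgb : edges B = pair_edge @: [set: gT * gT].
Proof.
apply/setP=> f; rewrite inE; apply/existsP/imsetP => [[u /existsP[v]]|[u _ ->]].
  case/andP=> auv /eqP->; case: u auv => [u|H].
    by rewrite sgb_adj_pair => /eqP->; exists u.
  rewrite adj_sym; case: v => // u; rewrite sgb_adj_pair => /eqP->.
  by exists u; rewrite // setUC.
exists (inl u); apply/existsP; exists (inr (pair_group u)).
by rewrite sgb_adj_pair !eqxx.
Qed.

Lemma card_edges_sgb : #|edges B| = (#|gT| ^ 2)%N.
Proof.
by rewrite edges_sgb (card_imset _ pair_edge_inj) cardsT card_prod mulnn.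
Qed.

Lemma card_vertex_sgb : #|vertex B| = (#|gT| ^ 2 + #|{group gT}|)%N.
Proof. by rewrite card_sum card_prod mulnn. Qed.

(** The edge of a pair generating H contributes 1 * N(H), and there are N(H)
    such edges. *)
Lemma zagreb2_sgb : zagreb2 B = (\sum_(H : {group gT}) gen_pairs H ^ 2)%N.
Proof.
rewrite /zagreb2 edges_sgb big_imset /=; last by move=> u v _ _ /pair_edge_inj.
rewrite (partition_big (@pair_group gT) xpredT) //=; apply: eq_bigr => H _.
rewrite (eq_bigr (fun=> gen_pairs H)) => [|u /andP[_ /eqP<-]].
  rewrite sum_nat_const -mulnn; congr (_ * _)%N.
  by rewrite /gen_pairs; apply: eq_card => u; rewrite unfold_in !inE.
by rewrite big_setU1 ?inE //= big_set1 deg_pair deg_subgroup mul1n.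
Qed.

End ZagrebOfSgb.

(** Cauchy-Schwarz against the constant function 1, obtained by summing
    2xy <= x^2 + y^2 over all pairs of indices. *)
Lemma sum_sq_leq (I : finType) (F : I -> nat) :
  ((\sum_i F i) ^ 2 <= #|I| * \sum_i F i ^ 2)%N.
Proof.
have e1: (\sum_i \sum_j (F i * F j) = (\sum_i F i) ^ 2)%N.
  by rewrite -mulnn big_distrlr.
have e2: (\sum_i \sum_(j : I) F i ^ 2 = #|I| * \sum_i F i ^ 2)%N.
  by rewrite big_distrr; apply: eq_bigr => i _; rewrite sum_nat_const.
have e3: (\sum_(i : I) \sum_j F j ^ 2 = #|I| * \sum_i F i ^ 2)%N.
  by rewrite sum_nat_const.
rewrite -(leq_pmul2l (isT : 0 < 2)%N) -e1 [leqRHS]mul2n -addnn.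
rewrite -{1}e2 -e3 -big_split.
rewrite big_distrr /=; apply: leq_sum => i _; rewrite -big_split big_distrr /=.
by apply: leq_sum => j _; apply: nat_Cauchy.
Qed.

(** With g = |G|^2 edges and l = |L(G)|, clearing denominators in
    (g + S) / (g + l) <= S / g leaves g^2 <= l * S. *)
Lemma zagreb_mean_leq (gT : finGroupType) (B := sgb_graph gT) :
  ((zagreb1 B)%:R / #|vertex B|%:R <= (zagreb2 B)%:R / #|edges B|%:R :> rat)%R.
Proof.
rewrite /B zagreb1_sgb zagreb2_sgb card_edges_sgb card_vertex_sgb.
have g0: (0 < #|gT|)%N by rewrite -cardsT cardG_gt0.
rewrite ler_pdivrMr ?ltr0n ?addn_gt0 ?expn_gt0 ?g0 // mulrAC.
rewrite ler_pdivlMr ?ltr0n ?expn_gt0 ?g0 // -!natrM ler_nat.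
have := @sum_sq_leq {group gT} (@gen_pairs gT); rewrite sum_gen_pairs_all.
set S := (\sum_H _ ^ 2)%N; set n := #|{group gT}|; set g := (#|gT| ^ 2)%N; nia.
Qed.

(** * Generating pairs in cyclic groups *)

Section Cyclic.
Variable gT : finGroupType.
Implicit Types C K : {group gT}.

Lemma sum_cyclic_subgroups C (F : {group gT} -> nat) (f : nat -> nat) :
    cyclic C -> (forall K, K \subset C -> F K = f #|K|) ->
  \sum_(K : {group gT} | K \subset C) F K = \sum_(d <- divisors #|C|) f d.
Proof.
case/cyclicP=> a defC Ff; have C0 := cardG_gt0 C.
transitivity (\sum_(d <- divisors #|C|)
                \sum_(K : {group gT} | (K \subset C) && (#|K| == d)) f d).
  rewrite (exchange_big_dep (fun K : {group gT} => K \subset C)) /=; last first.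
    by move=> d K _ /andP[].
  apply: eq_bigr => K sKC; rewrite Ff // big_mkcond.
  rewrite (bigD1_seq #|K|) ?divisors_uniq //=; last first.
    by rewrite -dvdn_divisors // cardSg.
  by rewrite sKC eqxx big1 /= ?addn0 // => d; rewrite eq_sym => /negPf-> //.
rewrite big_seq [RHS]big_seq; apply: eq_bigr => d.
rewrite -dvdn_divisors // defC => /(cycle_sub_group (a := a))/setP e.
rewrite (big_pred1 <[(a ^+ (#[a]%g %/ d))%g]>%G) // => K.
by have:= e K; rewrite !inE.
Qed.

(** The function [f] is Jordan's totient J_2 on the divisors of the order: the
    divisor-sum identity determines it recursively. *)
Lemma gen_pairs_cyclic C : cyclic C ->
  exists2 f : nat -> nat, forall K, K \subset C -> gen_pairs K = f #|K|
    & forall d, d %| #|C| -> \sum_(e <- divisors d) f e = (d ^ 2)%N.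
Proof.
case/cyclicP=> a defC.
pose K_ d := <[(a ^+ (#[a]%g %/ d))%g]>%G.
have cK K : K \subset C -> K = K_ #|K|.
  move=> sKC; have dK: #|K| %| #[a]%g by rewrite orderE -defC cardSg.
  by apply/set1P; rewrite -(cycle_sub_group dK) inE -defC sKC eqxx.
exists (fun d => gen_pairs (K_ d)) => [K sKC|d dC]; first by rewrite {1}(cK K).
have dK: d %| #[a]%g by rewrite orderE -defC.
have: K_ d \in [set K_ d] by rewrite set11.
rewrite -(cycle_sub_group dK) inE -defC => /andP[sKC /eqP{1 2}<-].
rewrite -(sum_gen_pairs (K_ d)); apply/esym/sum_cyclic_subgroups.
  exact: cycle_cyclic.
by move=> K sKK; rewrite {1}(cK K) // (subset_trans sKK).
Qed.

End Cyclic.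

(** * The structure of a dicyclic group *)

Lemma dicyclic_relators (n : nat) (gT : finGroupType) (G : {group gT}) :
  reflect (exists a b : gT, [/\ <[a]> <*> <[b]> = G, a ^+ (2 * n) = 1,
             b ^+ 2 = a ^+ n & b * a * b^-1 = a^-1])%g
    (G \homg Grp (a : b : a ^+ (2 * n), b ^+ 2 = a ^+ n,
                  b * a * b^-1 = a^-1))%g.
Proof.
apply: (iffP existsP) => [[[a b] /=]|[a [b [d1 d2 d3 d4]]]].
  by rewrite !xpair_eqE => /and4P[/eqP ? /eqP ? /eqP ? /eqP ?]; exists a, b.
by exists (a, b); rewrite /= d1 d2 d3 d4.
Qed.

Section DicyclicModel.
Variable n : nat.
Hypothesis n_gt0 : (0 < n)%N.
Let m_gt1 : (1 < 2 * n)%N. Proof. lia. Qed.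
Let Z := 'Z_(2 * n).

Let nn0 : (n%:R + n%:R = 0 :> Z)%R.
Proof. by rewrite -natrD addnn -mul2n pchar_Zp. Qed.

(** Right regular representation of the dicyclic group of order 4n: [(i, s)]
    stands for a^i b^s with i modulo 2n, and [turn], [flip] are right
    multiplication by a and by b, as a^i b a = a^(i-1) b and a^i b b = a^(i+n). *)
Definition turn (x : Z * bool) : Z * bool :=
  (if x.2 then x.1 - 1 else x.1 + 1, x.2)%R.
Definition flip (x : Z * bool) : Z * bool :=
  (if x.2 then x.1 + n%:R else x.1, ~~ x.2)%R.

Lemma turn_inj : injective turn.
Proof.
apply: (can_inj (g := fun x => (if x.2 then x.1 + 1 else x.1 - 1, x.2)%R)).
by case=> i []; rewrite /= ?subrK ?addrK.
Qed.

Lemma flip_inj : injective flip.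
Proof.
apply: (can_inj (g := fun x => (if x.2 then x.1 else x.1 - n%:R, ~~ x.2)%R)).
by case=> i []; rewrite /= ?addrK.
Qed.

Definition turn_perm := perm turn_inj.
Definition flip_perm := perm flip_inj.

Lemma turn_permX k x :
  (turn_perm ^+ k)%g x = ((if x.2 then x.1 - k%:R else x.1 + k%:R)%R, x.2).
Proof.
rewrite permX; elim: k => [|k IHk].
  by case: x => i []; rewrite /= ?subr0 ?addr0.
rewrite iterS {}IHk permE /turn -natr1; case: x => i [] /=.
  by rewrite opprD addrA.
by rewrite addrA.
Qed.

Lemma order_turn : #[turn_perm]%g = (2 * n)%N.
Proof.
apply/eqP; rewrite eqn_dvd order_dvdn.
apply/andP; split.
  apply/eqP/permP=> x; rewrite turn_permX perm1 pchar_Zp //.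
  by case: x => i []; rewrite /= ?subr0 ?addr0.
have /(congr1 (fun s : {perm _} => (s (0, false)%R).1)) := expg_order turn_perm.
rewrite turn_permX perm1 /= add0r => /(congr1 (@nat_of_ord _)).
by rewrite val_Zp_nat //= /dvdn => ->.
Qed.

(** Powers of [turn_perm] preserve the second component, [flip_perm] does not. *)
Lemma flip_notin : flip_perm \notin <[turn_perm]>%g.
Proof.
apply/cycleP=> -[k /(congr1 (fun s : {perm _} => (s (0, false)%R).2))].
by rewrite turn_permX permE.
Qed.

Lemma flip_perm2 : (flip_perm ^+ 2 = turn_perm ^+ n)%g.
Proof.
apply/permP=> -[i s]; rewrite turn_permX expgS expg1 permM !permE /flip /=.
case: s => //=; congr (_, _); apply/eqP; rewrite -subr_eq0 opprB.
by rewrite addrA -(addrA i) nn0 addr0 subrr.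
Qed.

Lemma conj_turn : (flip_perm * turn_perm * flip_perm^-1 = turn_perm^-1)%g.
Proof.
apply: (mulIg flip_perm); rewrite mulgKV.
apply: (mulgI turn_perm); rewrite mulKVg.
apply/permP=> -[i s]; rewrite !permM !permE /turn /flip /=.
case: s => /=; last by rewrite addrK.
by rewrite addrAC subrK.
Qed.

(** The group generated by both permutations properly contains a subgroup of
    order 2n, hence has at least twice that order. *)
Lemma dicyclic_model : exists (rT : finGroupType) (H : {group rT}),
  (4 * n <= #|H|)%N /\
  (H \homg Grp (a : b : a ^+ (2 * n), b ^+ 2 = a ^+ n, b * a * b^-1 = a^-1))%g.
Proof.
exists {perm Z * bool}, (<[turn_perm]> <*> <[flip_perm]>)%G; split; last first.
  apply/dicyclic_relators; exists turn_perm, flip_perm.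
  split; rewrite ?flip_perm2 ?conj_turn //.
  by apply/eqP; rewrite -order_dvdn order_turn.
set H := (_ <*> _)%G; have sA: <[turn_perm]>%g \subset H by apply: joing_subl.
have: (<[turn_perm]> \proper H)%g.
  rewrite properE sA; apply: contra flip_notin => /subsetP; apply.
  by rewrite -cycle_subG joing_subr.
move/proper_card; have := cardSg sA; rewrite -orderE order_turn.
by case/dvdnP=> [[|[|k]] ->]; nia.
Qed.

End DicyclicModel.

(** The relators give |G| <= 2 * #[a] <= 4n, and a dicyclic group maps onto the
    model, which has order at least 4n; so all these bounds are equalities.
    Outside the cyclic subgroup, (a^i b)^2 = a^i (b a^i b^-1) b^2 = b^2. *)
Lemma dicyclic_struct (n : nat) (gT : finGroupType) :
    (0 < n)%N -> dicyclic n gT ->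
  exists a : gT, [/\ #[a]%g = (2 * n)%N, #|gT| = (4 * n)%N
    & forall x, x \notin <[a]>%g -> (x ^+ 2 = a ^+ n)%g].
Proof.
move=> n_gt0 isoG.
have [rT [H [leH homH]]] := dicyclic_model n_gt0.
have {}leH: (4 * n <= #|gT|)%N.
  apply: leq_trans leH _; move: homH; rewrite -isoG => /leq_homg.
  by rewrite cardsT.
have /dicyclic_relators[a [b [defG a2n b2 ab]]] := isoGrp_hom isoG.
have aJb: (a ^ b^-1 = a^-1)%g by rewrite conjgE invgK mulgA.
have nAb: b \in 'N(<[a]>)%g.
  by rewrite -groupV; apply/normP; rewrite -cycleJ aJb cycleV.
have defAB: (<[a]> * <[b]> = [set: gT])%g.
  by rewrite -norm_joinEr ?cycle_subG.
have outA x : x \notin <[a]>%g -> exists i, x = (a ^+ i * b)%g.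
  have: x \in (<[a]> * <[b]>)%g by rewrite defAB inE.
  case/mulsgP=> _ _ /cycleP[i ->] /cycleP[j ->] ->.
  rewrite -(odd_double_half j) addnC -mul2n expgD expgM b2 -expgM mulgA -expgD.
  case: (odd j) => [_|]; first by exists (i + n * j./2)%N.
  by rewrite mulg1 mem_cycle.
have a_dv: #[a]%g %| 2 * n by rewrite order_dvdn a2n.
(* G is covered by the subgroup of a and its coset by b. *)
have leG: (#|gT| <= #[a]%g + #[a]%g)%N.
  rewrite {2}orderE -(card_rcoset <[a]>%g b) -cardsT.
  apply: leq_trans (subset_leq_card _) (leq_card_setU _ _).
  apply/subsetP=> x _; rewrite inE; case: (boolP (x \in _)) => //= /outA[i ->].
  by rewrite mem_rcoset mulgK mem_cycle.
have := dvdn_leq _ a_dv; rewrite muln_gt0 n_gt0 => /(_ isT) le_a.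
exists a; split=> [||x /outA[i ->]]; try lia.
have baE: (b * a ^+ i = a ^- i * b)%g.
  by rewrite -expgVn -aJb -conjXg conjgE invgK -!mulgA mulVg mulg1.
by rewrite expgS expg1 -mulgA (mulgA b) baE -mulgA mulKVg.
Qed.

(** * Subgroups of the dicyclic group of order 4p *)

Section SubgroupsOfDicyclic.
Variables (p : nat) (gT : finGroupType) (a : gT).
Hypotheses (p_pr : prime p) (oa : #[a]%g = (2 * p)%N).
Hypotheses (oG : #|gT| = (4 * p)%N).
Hypothesis sq_out : forall x, x \notin <[a]>%g -> (x ^+ 2 = a ^+ p)%g.
Implicit Types H : {group gT}.
Let A := <[a]>%G.

Let p_gt1 : (1 < p)%N. Proof. exact: prime_gt1. Qed.
Let cA : #|A| = (2 * p)%N. Proof. exact: oa. Qed.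

(** The square is a^p, the involution of A. *)
Lemma order_out x : x \notin A -> #[x]%g = 4.
Proof.
move=> /sq_out x2; have ap2: ((a ^+ p) ^+ 2 = 1)%g.
  by rewrite -expgM mulnC -oa expg_order.
have ap1: (a ^+ p != 1)%g.
  by rewrite -order_dvdn oa; apply/negP => /dvdn_leq; lia.
have: #[x]%g %| 4 by rewrite order_dvdn (expgM x 2 2) x2 ap2.
have: ~~ (#[x]%g %| 2) by rewrite order_dvdn x2.
by rewrite (dvdn_divisors _ (isT : 0 < 4)%N) !inE => /[swap] /or3P[]/eqP->.
Qed.

(** As A has index 2 in the whole group, the product formula bounds the index
    of [H :&: A] in H by 2, and [x] shows that the index is not 1.  The
    intersection has even order because it contains the involution x^2. *)
Lemma cap_out H x : x \in H -> x \notin A ->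
  (#|H| = 2 * #|H :&: A|)%N /\ 2 %| #|H :&: A|.
Proof.
move=> Hx nAx; split.
  have leHA: (#|H * A|%g <= 4 * p)%N by rewrite -oG max_card.
  have ltHA: (#|H :&: A| < #|H|)%N.
    apply/proper_card; rewrite properE subsetIl subsetI subxx /=.
    by apply: contra nAx => /subsetP->.
  have le2 : (#|H| <= 2 * #|H :&: A|)%N.
    rewrite -(leq_pmul2r (_ : 0 < 2 * p)%N) ?muln_gt0 ?prime_gt0 // -{1}cA.
    by rewrite mul_cardG mulnAC mulnA leq_pmul2r ?cardG_gt0.
  have /dvdnP[k eH] := cardSg (subsetIl H A).
  have m_gt0 := cardG_gt0 (H :&: A)%G.
  move: ltHA le2; rewrite eH -{1}[#|_|]mul1n ltn_pmul2r // leq_pmul2r //.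
  by case: k {eH} => [|[|[|k]]].
have ox := order_out nAx.
have o2: #[x ^+ 2]%g = 2 by rewrite orderXdiv ox.
by rewrite -o2; apply: order_dvdG; rewrite inE groupX //= sq_out // mem_cycle.
Qed.

(** Writing |H :&: A| = 2k, Lagrange in A gives k | p, so k = 1 or k = p. *)
Lemma subgroup_out H : ~~ (H \subset A) ->
  H = [set: gT]%G \/ #|H| = 4.
Proof.
case/subsetPn=> x Hx nAx; have [cH /dvdnP[k]] := cap_out Hx nAx.
rewrite mulnC => cHA; have: #|H :&: A| %| #|A| by rewrite cardSg ?subsetIr.
rewrite cHA cA dvdn_pmul2l // => /(primeP p_pr).2.
case/orP=> /eqP k_eq; [right | left]; first by rewrite cH cHA k_eq.
apply/val_inj/eqP; rewrite eqEcard subsetT /= cardsT oG cH cHA k_eq; lia.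
Qed.

Lemma cycle_out H x : #|H| = 4 -> x \in H -> x \notin A -> <[x]>%G = H.
Proof.
move=> cH Hx nAx; apply/val_inj/eqP; rewrite eqEcard cycle_subG Hx /=.
by rewrite -orderE cH order_out.
Qed.

Lemma setT_out : ~~ ([set: gT]%G \subset A).
Proof.
apply/negP=> /subset_leq_card; rewrite /= cardsT oG cA; lia.
Qed.

(** The 2p elements outside A are sorted by the subgroup they generate; each
    class consists of the two elements of a subgroup of order 4 lying outside
    A. *)
Lemma card_order4_out :
  #|[pred H : {group gT} | ~~ (H \subset A) & H != [set: gT]%G]| = p.
Proof.
set S := [pred H | _ & _].
have: #|~: A| = (2 * p)%N.
  by have := cardsC A; rewrite cA oG; lia.
rewrite -sum1_card (partition_big (fun x => <[x]>%G) S) /=; last first.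
  move=> x; rewrite inE cycle_subG => nAx; rewrite nAx /=.
  apply/eqP=> /(congr1 (fun H : {group gT} => #|H|)) /=.
  by rewrite -orderE order_out // cardsT oG; lia.
rewrite (eq_bigr (fun=> 2)) ?sum_nat_const.
  by rewrite mulnC => /eqP; rewrite eqn_pmul2l // => /eqP.
move=> H /andP[nsHA ntH]; case: (subgroup_out nsHA) => [eH|cH].
  by rewrite eH eqxx in ntH.
have /subsetPn[x Hx nAx] := nsHA; have [cHA _] := cap_out Hx nAx.
have := cardsID A H; rewrite cH in cHA *; rewrite sum1_card.
suff ->: #|[pred y in ~: A | <[y]>%G == H]| = #|H :\: A| by lia.
apply: eq_card => y; rewrite !inE.
case: (boolP (y \in A)) => //= nAy.
by apply/eqP/idP => [<-|Hy]; [apply: cycle_id | apply: cycle_out].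
Qed.

(** Applied to F = N, where the left side is known, this yields N(G); applied
    to F = N^2 it yields the second Zagreb index. *)
Lemma sum_subgroups (F : {group gT} -> nat) (c : nat) :
    (forall H, ~~ (H \subset A) -> #|H| = 4 -> F H = c) ->
  \sum_H F H = (\sum_(H : {group gT} | H \subset A) F H + p * c
                 + F [set: gT]%G)%N.
Proof.
move=> Fc; rewrite (bigID (fun H => H \subset A)) /= -addnA; congr (_ + _)%N.
rewrite (bigD1 [set: gT]%G) ?setT_out //= addnC; congr (_ + _)%N.
rewrite (eq_bigr (fun=> c)) ?sum_nat_const ?card_order4_out // => H.
case/andP=> nsHA ntH; case: (subgroup_out nsHA) => [eH|/Fc->//].
by rewrite eH eqxx in ntH.
Qed.

(** The totient recursion at 1, 2 and 4 gives 16 - 4 = 12. *)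
Lemma gen_pairs_order4 H : ~~ (H \subset A) -> #|H| = 4 -> gen_pairs H = 12.
Proof.
case/subsetPn=> x Hx nAx cH.
have: cyclic H by rewrite -(cycle_out cH Hx nAx) cycle_cyclic.
case/gen_pairs_cyclic=> f -> // sumf; rewrite cH in sumf *.
have := sumf 4; have := sumf 2; have := sumf 1.
rewrite /divisors /= !big_cons !big_nil; lia.
Qed.

(** All pairs, minus the 4p^2 pairs of elements of A, minus 12 for each of the
    p subgroups of order 4 outside A. *)
Lemma gen_pairs_setT : gen_pairs [set: gT]%G = (12 * p ^ 2 - 12 * p)%N.
Proof.
have := sum_gen_pairs_all gT; rewrite (sum_subgroups gen_pairs_order4).
rewrite sum_gen_pairs oG cA !expnMn; lia.
Qed.

Lemma sum_gen_pairs_sq : exists2 f : nat -> nat,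
  forall d, d %| 2 * p -> \sum_(e <- divisors d) f e = (d ^ 2)%N
  & \sum_(H : {group gT}) gen_pairs H ^ 2
    = (\sum_(d <- divisors (2 * p)) f d ^ 2 + p * 144
        + (12 * p ^ 2 - 12 * p) ^ 2)%N.
Proof.
have [f gf sumf] := gen_pairs_cyclic (cycle_cyclic a : cyclic A).
rewrite cA in sumf; exists f => //.
rewrite (@sum_subgroups _ 144) ?gen_pairs_setT; last first.
  by move=> H nsHA cH; rewrite gen_pairs_order4.
congr (_ + _ + _)%N; rewrite -cA.
apply: (sum_cyclic_subgroups (f := fun d => f d ^ 2)%N).
  exact: cycle_cyclic.
by move=> K sKA; rewrite gf.
Qed.

End SubgroupsOfDicyclic.

(** * Evaluation of the divisor sums *)

Lemma sum_divisors_prime (q : nat) (f : nat -> nat) : prime q ->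
  \sum_(d <- divisors q) f d = (f 1 + f q)%N.
Proof.
move=> q_pr; have q1 := prime_gt1 q_pr; rewrite (perm_big [:: 1; q]).
  by rewrite !big_cons big_nil /= addn0.
apply: uniq_perm => [||d]; rewrite ?divisors_uniq //= ?inE ?andbT; first by lia.
rewrite -dvdn_divisors ?prime_gt0 //.
apply/idP/orP => [/(primeP q_pr).2/orP//|].
by case=> /eqP->; rewrite ?dvd1n ?dvdnn.
Qed.

Lemma sum_divisors_double_prime (q : nat) (f : nat -> nat) : prime q -> 2 < q ->
  \sum_(d <- divisors (2 * q)) f d = (f 1 + f 2 + f q + f (2 * q))%N.
Proof.
move=> q_pr q2; rewrite (perm_big [:: 1; 2; q; 2 * q]).
  by rewrite !big_cons big_nil /= addn0 !addnA.
apply: uniq_perm => [||d]; rewrite ?divisors_uniq //= ?inE; first by lia.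
rewrite -dvdn_divisors ?muln_gt0 ?prime_gt0 //; apply/idP/or4P; last first.
  case=> /eqP->; rewrite ?dvd1n ?dvdnn ?(dvdn_mulr _ (dvdnn 2)) //.
  by rewrite dvdn_mull.
case: (boolP (2 %| d)) => [/dvdnP[k ->]|].
  rewrite mulnC dvdn_pmul2l // => /(primeP q_pr).2/orP[]/eqP->.
    by rewrite muln1; constructor 2.
  by constructor 4.
rewrite dvdn2 negbK => d_odd; rewrite Gauss_dvdr ?coprimen2 //.
case/(primeP q_pr).2/orP => /eqP->; [by constructor 1 | by constructor 3].
Qed.

(** * The Zagreb indices of the dicyclic group of order 4p *)

Local Open Scope ring_scope.

Theorem theorem3p8 (p : nat) (gT : finGroupType) (p_pr : prime p)
    (dicG : dicyclic p gT) :
  let B := sgb_graph gT in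
  let M1 := zagreb1 B in
  let M2 := zagreb2 B in
  [/\ p = 2%N -> M1 = 1082%N /\ M2 = 1018%N,
      (3 <= p)%N ->
        M1%:Z = 154 * p%:Z ^+ 4 - 288 * p%:Z ^+ 3 + 140 * p%:Z ^+ 2
                + 144 * p%:Z + 20
        /\ M2%:Z = 154 * p%:Z ^+ 4 - 288 * p%:Z ^+ 3 + 124 * p%:Z ^+ 2
                   + 144 * p%:Z + 20
    & (M2%:R / #|edges B|%:R : rat) >= M1%:R / #|vertex B|%:R].
Proof.
have [a [oa oG sq_out]] := dicyclic_struct (prime_gt0 p_pr) dicG.
have [f sumf sumsq] := sum_gen_pairs_sq p_pr oa oG sq_out.
move=> B M1 M2; have M1E : M1 = (16 * p ^ 2 + M2)%N.
  by rewrite /M1 /M2 zagreb1_sgb zagreb2_sgb oG expnMn.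
have {sumsq} M2E := etrans (zagreb2_sgb gT) sumsq; rewrite -/M2 in M2E.
split; last exact: zagreb_mean_leq.
- move=> p2; rewrite M1E M2E; rewrite p2 in sumf *.
  have := sumf 4%N; have := sumf 2%N; have := sumf 1%N.
  rewrite /divisors /= !big_cons !big_nil; nia.
move=> p3.
have d1 : f 1%N = 1%N by have := sumf 1%N; rewrite dvd1n big_seq1 => ->.
have d2 : f 2%N = 3%N.
  have := sumf 2%N; rewrite dvdn_mulr // (sum_divisors_prime f (isT : prime 2)).
  by rewrite d1 => /(_ isT); lia.
have dp : f p = (p ^ 2 - 1)%N.
  have := sumf p; rewrite dvdn_mull // (sum_divisors_prime f p_pr).
  by rewrite d1 => /(_ isT); lia.
have d2p : f (2 * p)%N = (3 * (p ^ 2 - 1))%N.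
  have := sumf (2 * p)%N; rewrite dvdnn (sum_divisors_double_prime f p_pr p3).
  by rewrite expnMn => /(_ isT); lia.
rewrite (sum_divisors_double_prime (fun d => f d ^ 2)%N p_pr p3) in M2E.
rewrite d1 d2 dp d2p in M2E; rewrite M1E M2E.
(* Substituting p = q + 1 removes the truncated subtractions. *)
have [q ->] : exists q, p = q.+1 by exists p.-1; lia.
have -> : (q.+1 ^ 2 - 1 = q * (q + 2))%N by lia.
have -> : (12 * q.+1 ^ 2 - 12 * q.+1 = 12 * q.+1 * q)%N by lia.
rewrite -addn1 -!mulnn !(PoszD, PoszM).
by split; ring.
Qed.
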